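(* Let $a\in\mathbb{Z}$ and let $\alpha$ be a root of $X^3-(a-1)X^2-(a+2)X-1$. Then $\omega(\mathbb{Z}[\alpha])\leq 2$, i.e. every nonzero element of $\mathbb{Z}[\alpha]$ can be written as $a_1\nu_1+\dots+a_\ell\nu_\ell$ with pairwise distinct units $\nu_1,\dots,\nu_\ell\in\mathbb{Z}[\alpha]^*$ and coefficients $a_i\in\{1,2\}$.
   Context: For an order $\mathcal{O}$ of a number field, $\omega(\mathcal{O})$ denotes $\omega_{\mathcal{O}^*}(\mathcal{O})$, where for a subring $R$ of a field $F$ of characteristic $0$ and a finitely generated subgroup $\Gamma\subset F^*$: $\omega_{R,\Gamma}(\alpha)$ is the least $a_1$ over all representations $\alpha=a_1\nu_1+\dots+a_\ell\nu_\ell$ with pairwise distinct $\nu_i\in\Gamma\cap R$ and integers $a_1\geq\dots\geq a_\ell>0$ ($\omega_{R,\Gamma}(0)=0$, and $\infty$ if no representation exists), and $\omega_\Gamma(R)=\max_{\alpha\in R}\omega_{R,\Gamma}(\alpha)$ when the maximum exists. *)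

(* Defs.v *)
From HB Require Import structures.
From mathcomp Require Import all_boot all_order all_algebra all_field.
Set Implicit Arguments. Unset Strict Implicit. Unset Printing Implicit Defensive.
Import Order.TTheory GRing.Theory Num.Theory.
Local Open Scope ring_scope.

Definition in_Zadj (alpha beta : algC) : Prop :=
  exists p : {poly int}, beta = (map_poly intr p).[alpha].

Definition is_unit_of (R : algC -> Prop) (nu : algC) : Prop :=
  R nu /\ exists mu : algC, R mu /\ nu * mu = 1.

Definition unit_rep (R : algC -> Prop) (beta : algC) (s : seq (nat * algC)) : Prop :=
  [/\ sorted geq [seq x.1 | x <- s],
      all (fun x => 0 < x.1)%N s,
      uniq [seq x.2 | x <- s],
      (forall x, x \in s -> is_unit_of R x.2) &
      beta = \sum_(x <- s) x.1%:R * x.2].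

Definition omega_le (R : algC -> Prop) (beta : algC) (k : nat) : Prop :=
  beta = 0 \/ exists s, unit_rep R beta s /\ (head 0%N [seq x.1 | x <- s] <= k)%N.

Definition omega_ring_le (R : algC -> Prop) (k : nat) : Prop :=
  forall beta, R beta -> omega_le R beta k.

(* Main.v *)
(* The units 1, alpha and - (alpha + 1) add up to 0, so the sum of their cubes
   is three times their product; hence 3 is a sum of three units, and three
   equal "chips" on a unit (-1)^b alpha^i (alpha + 1)^j can be fired to three
   neighbouring units. On the column index i - j the fired chips move by 0, 3
   and - 3, which forces termination, leaving at most two chips on each unit.
   Distinct (b, i, j) give distinct units: a relation between alpha and
   alpha + 1 also holds for the conjugate - 1 / (alpha + 1), and together they
   give |alpha| = |alpha + 1| = 1, so alpha^2 + alpha + 1 = 0, which makes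
   alpha rational. *)
Require Import Defs.
From HB Require Import structures.
From mathcomp Require Import all_boot all_order all_algebra all_field.
From mathcomp Require Import ring zify.
Import Order.TTheory GRing.Theory Num.Theory.
Local Open Scope ring_scope.

(** * Termination of chip firing *)

Lemma perm_count3 (T : eqType) (x : T) (s : seq T) :
  (2 < count_mem x s)%N -> exists r, perm_eq s [:: x, x, x & r].
Proof.
have rem1 (t : seq T) n : (n < count_mem x t)%N ->
    exists2 r, perm_eq t (x :: r) & (n <= count_mem x r)%N.
  move=> nt; have xt : x \in t by rewrite -has_pred1 has_count; lia.
  exists (rem x t); first exact: perm_to_rem.
  by have /permP/(_ (pred1 x)) := perm_to_rem xt; rewrite /= eqxx; lia.
case/rem1=> r1 e1 /rem1[r2 e2 /rem1[r3 e3 _]]; exists r3.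
apply: (perm_trans e1); rewrite perm_cons; apply: (perm_trans e2).
by rewrite perm_cons.
Qed.

(* A column never empties, since one fired chip stays in it; so at most
   [size s] columns are ever occupied. While the set of occupied columns is
   unchanged, each firing increases the bounded sum of the squared columns by
   [2 d ^ 2]. *)
Lemma chip_firing (T : eqType) (V : zmodType) (val : T -> V)
    (f0 f1 f2 : T -> T) (col : T -> int) (d : int) :
    d != 0 ->
    (forall x, col (f0 x) = col x) ->
    (forall x, col (f1 x) = col x + d) ->
    (forall x, col (f2 x) = col x - d) ->
    (forall x, val x *+ 3 = val (f0 x) + val (f1 x) + val (f2 x)) ->
  forall s : seq T, exists s' : seq T,
    \sum_(x <- s) val x = \sum_(x <- s') val x /\
    (forall x, count_mem x s' <= 2)%N.
Proof.
move=> d0 col0 col1 col2 fire.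
(* Lexicographic induction: [k] bounds how many columns can still become occupied, and [m] bounds
   the total deficit of the squared columns from [B]. *)
suff main k m (B : int) s : all (fun x => col x ^+ 2 <= B) s ->
    (size s <= size (undup (map col s)) + k)%N ->
    \sum_(x <- s) (B - col x ^+ 2) <= m%:Z ->
    exists s' : seq T, \sum_(x <- s) val x = \sum_(x <- s') val x /\
      (forall x, count_mem x s' <= 2)%N.
  move=> s; pose B : int := \sum_(x <- s) col x ^+ 2.
  apply: (main (size s) `|(\sum_(x <- s) (B - col x ^+ 2))%R|%N B s).
  - apply/allP => x xs; rewrite /B (big_rem x) //= lerDl.
    by apply: sumr_ge0 => y _; rewrite sqr_ge0.
  - exact: leq_addl.
  - by rewrite abszE ler_norm.
elim/ltn_ind: k m B s => k IHk; elim/ltn_ind=> m IHm B s sB sk sm.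
have [s2|] := boolP (all (fun x => count_mem x s <= 2)%N s).
  exists s; split=> // x; have [xs|xs] := boolP (x \in s); first exact: (allP s2).
  by rewrite (count_memPn xs).
case/allPn=> x xs; rewrite -ltnNge => /perm_count3[r sr].
pose s' := [:: f0 x, f1 x, f2 x & r].
have -> : \sum_(y <- s) val y = \sum_(y <- s') val y.
  by rewrite (perm_big _ sr) !big_cons /= !addrA -fire 2!mulrSr mulr1n.
have size_s' : size s' = size s by rewrite (perm_size sr).
have sub_s' : {subset undup (map col s) <= undup (map col s')}.
  move=> c; rewrite !mem_undup (perm_mem (perm_map col sr)) /= !inE col0.
  by case/or4P=> ->; rewrite ?orbT.
have le_s' := uniq_leq_size (undup_uniq _) sub_s'.
have le_size : (size (undup (map col s')) <= size s')%N.
  by rewrite (leq_trans (size_undup _)) ?size_map.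
have [old|/allPn[c cs' cs]] := boolP (all (mem (map col s)) (map col s')).
  have s'B : all (fun y => col y ^+ 2 <= B) s'.
    by apply/allP => y /(map_f col)/(allP old)/mapP[z zs ->]; exact: (allP sB).
  have s'0 : 0 <= \sum_(y <- s') (B - col y ^+ 2).
    rewrite big_seq; apply: sumr_ge0 => y /(allP s'B).
    by rewrite subr_ge0.
  have ss' : \sum_(y <- s') (B - col y ^+ 2) =
             \sum_(y <- s) (B - col y ^+ 2) - d ^+ 2 *+ 2.
    by rewrite (perm_big _ sr) !big_cons col0 col1 col2 /=; ring.
  have d2 : 0 < d ^+ 2 by rewrite lt_neqAle sqr_ge0 eq_sym sqrf_eq0 d0.
  apply: (IHm `|(\sum_(y <- s') (B - col y ^+ 2))%R|%N _ B) => //; first by lia.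
  - by lia.
  - by rewrite abszE ler_norm.
have lt_s' : (size (undup (map col s)) < size (undup (map col s')))%N.
  apply: (@uniq_leq_size _ (c :: undup (map col s))).
    by rewrite /= mem_undup cs undup_uniq.
  by move=> b; rewrite inE => /predU1P[->|/sub_s'//]; rewrite mem_undup.
(* A new column has been opened, so the first component drops; the bound and the deficit start
   afresh. *)
pose B' : int := \sum_(y <- s') col y ^+ 2.
apply: (IHk (size s' - size (undup (map col s')))%N _
  `|(\sum_(y <- s') (B' - col y ^+ 2))%R|%N B').
- by lia.
- apply/allP => y ys; rewrite /B' (big_rem y) //= lerDl.
  by apply: sumr_ge0 => z _; rewrite sqr_ge0.
- by lia.
- by rewrite abszE ler_norm.
Qed.

(** * Shanks' simplest cubic f with parameter a - 1: irreducibility over the rationals *)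

Definition simplest_cubic (R : nzRingType) (a : int) : {poly R} :=
  Poly [:: -1; - (a + 2)%:~R; - (a - 1)%:~R; 1].

Lemma polyseq_simplest_cubic (R : nzRingType) (a : int) :
  simplest_cubic R a = [:: -1; - (a + 2)%:~R; - (a - 1)%:~R; 1] :> seq R.
Proof. by rewrite (PolyK (c := 0)) //= oner_neq0. Qed.

Lemma map_simplest_cubic (R S : nzRingType) (f : {rmorphism R -> S}) (a : int) :
  map_poly f (simplest_cubic R a) = simplest_cubic S a.
Proof.
apply/polyP=> i; rewrite coef_map !polyseq_simplest_cubic.
by case: i => [|[|[|[|i]]]] /=; rewrite ?nth_nil
  ?rmorphN ?rmorph_int ?rmorph1 ?rmorph0.
Qed.

Lemma root_simplest_cubic (R : comNzRingType) (a : int) (x : R) :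
  root (simplest_cubic R a) x =
  (x ^+ 3 - (a - 1)%:~R * x ^+ 2 - (a + 2)%:~R * x - 1 == 0).
Proof.
rewrite rootE; congr (_ == _).
rewrite /simplest_cubic /= !horner_cons horner0; ring.
Qed.

(** A rational root would be an algebraic integer, hence an integer z; as f(0) = -1 and f(-1) = 1,
    both z and z + 1 would divide 1, which is impossible. *)
Lemma simplest_cubic_norootQ (a : int) (x : rat) : ~~ root (simplest_cubic rat a) x.
Proof.
apply/negP=> fx; have fxC: root (simplest_cubic algC a) (ratr x).
  by rewrite -(map_simplest_cubic _ _ (@ratr algC)) fmorph_root.
have: (ratr x : algC) \is a Num.int.
  apply: Cint_rat_Aint; first exact: Crat_rat.
  apply: root_monic_Aint fxC _ _.
    by rewrite monicE lead_coefE polyseq_simplest_cubic.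
  apply/polyOverP=> i; rewrite polyseq_simplest_cubic.
  by case: i => [|[|[|[|i]]]] /=; rewrite ?nth_nil
    ?rpredN ?rpred1 ?rpred_int ?rpred0.
case/intrP=> z xz; move: fxC; rewrite root_simplest_cubic xz.
rewrite -!rmorphXn /= -!rmorphM -!rmorphB /= -(rmorph1 intr).
rewrite -rmorphB intr_eq0 => /eqP fz.
have z1 : z * (z ^+ 2 - (a - 1) * z - (a + 2)) = 1.
  by apply/eqP; rewrite -subr_eq0 -fz; apply/eqP; ring.
have z2 : (z + 1) * (a * z + 2 - z ^+ 2) = 1.
  by apply/eqP; rewrite eq_sym -subr_eq0 -fz; apply/eqP; ring.
have unit1 (u v : int) : u * v = 1 -> (u == 1) || (u == -1).
  by move/(congr1 absz)/eqP; rewrite abszM muln_eq1 => /andP[/eqP uv _]; lia.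
by move: (unit1 _ _ z1) (unit1 _ _ z2); lia.
Qed.

(** By irreducibility gcd(f, q) is constant or associate to f, and the common root x excludes a
    constant. *)
Lemma simplest_cubic_conj (a : int) (x y : algC) (q : {poly rat}) :
  root (simplest_cubic algC a) x -> root (simplest_cubic algC a) y ->
  root (map_poly ratr q) x -> root (map_poly ratr q) y.
Proof.
rewrite -(map_simplest_cubic _ _ (@ratr algC)) => fx fy qx.
have irr : irreducible_poly (simplest_cubic rat a).
  apply: cubic_irreducible; first by rewrite polyseq_simplest_cubic.
  exact: simplest_cubic_norootQ.
have gx : root (map_poly ratr (gcdp (simplest_cubic rat a) q)) x.
  by rewrite gcdp_map root_gcd fx.
have : gcdp (simplest_cubic rat a) q %= simplest_cubic rat a.
  apply: (apply_irredp irr); last exact: dvdp_gcdl.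
  apply: contraL gx => /size_poly1P[c c0 ->].
  by rewrite map_polyC rootC fmorph_eq0.
rewrite /eqp => /andP[_]; rewrite dvdp_gcd dvdpp /= => fq.
by apply: root_dvdp fy; rewrite dvdp_map.
Qed.

(** The cofactor is (f + 1) / X; in the next lemma it is (1 - f) / (X + 1). Both are integral, so
    they provide inverses inside Z[x]. *)
Lemma simplest_cubic_inv (a : int) (x : algC) :
  root (simplest_cubic algC a) x ->
  x * (x ^+ 2 - (a - 1)%:~R * x - (a + 2)%:~R) = 1.
Proof.
by rewrite root_simplest_cubic => /eqP f0; rewrite -[RHS]add0r -f0; ring.
Qed.

Lemma simplest_cubic_inv1 (a : int) (x : algC) :
  root (simplest_cubic algC a) x ->
  (x + 1) * (a%:~R * x + 2 - x ^+ 2) = 1.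
Proof.
by rewrite root_simplest_cubic => /eqP f0; rewrite -[RHS]subr0 -f0; ring.
Qed.

Lemma simplest_cubic_neq0 (a : int) (x : algC) :
  root (simplest_cubic algC a) x ->
  x != 0.
Proof.
move=> fx; apply/eqP=> x0; have := simplest_cubic_inv _ _ fx.
by rewrite x0 mul0r => /eqP; rewrite eq_sym oner_eq0.
Qed.

Lemma simplest_cubic_neq0_1 (a : int) (x : algC) :
  root (simplest_cubic algC a) x ->
  x + 1 != 0.
Proof.
move=> fx; apply/eqP=> x0; have := simplest_cubic_inv1 _ _ fx.
by rewrite x0 mul0r => /eqP; rewrite eq_sym oner_eq0.
Qed.

(** * Multiplicative independence of x and x + 1 *)

Lemma simplest_cubic_conj_root (a : int) (x : algC) :
  root (simplest_cubic algC a) x ->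
  root (simplest_cubic algC a) (- (x + 1)^-1).
Proof.
move=> fx; have y0 := simplest_cubic_neq0_1 _ _ fx.
move: fx; rewrite !root_simplest_cubic => /eqP f0.
(* The identity is f(-1 / (x + 1)) = - f(x) / (x + 1)^3. *)
apply/eqP; rewrite -[RHS](mul0r ((x + 1) ^- 3)) -oppr0 -f0.
by field.
Qed.

(** Moving the negative powers to the other side turns the relation into the vanishing of a rational
    polynomial, which passes to any other root. *)
Lemma simplest_cubic_conj_monomial (a : int) (x y : algC) (i j : int) :
  root (simplest_cubic algC a) x -> root (simplest_cubic algC a) y ->
  x ^ i * (x + 1) ^ j = 1 -> y ^ i * (y + 1) ^ j = 1.
Proof.
move=> fx fy.
have splitz (k : int) : exists m n : nat, k = m%:Z - n%:Z.
  by case: k => n; [exists n, 0%N | exists 0%N, n.+1]; lia.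
case: (splitz i) (splitz j) => [i1 [i2 ->]] [j1 [j2 ->]].
have monomial (z : algC) : root (simplest_cubic algC a) z ->
    (z ^ (i1%:Z - i2%:Z) * (z + 1) ^ (j1%:Z - j2%:Z) == 1) =
    root (map_poly ratr
      ('X^i1 * ('X + 1) ^+ j1 - 'X^i2 * ('X + 1) ^+ j2 : {poly rat})) z.
  move=> fz; have z0 := simplest_cubic_neq0 _ _ fz.
  have z1 := simplest_cubic_neq0_1 _ _ fz.
  rewrite rootE rmorphB !rmorphM !rmorphXn /= rmorphD /= map_polyX rmorph1.
  rewrite !hornerE subr_eq0 !expfzDr // -!invr_expz -!exprnP mulf_div.
  have yz0 : z ^+ i2 * (z + 1) ^+ j2 != 0 by rewrite mulf_neq0 ?expf_neq0.
  by rewrite (can2_eq (divfK yz0) (mulfK yz0)) mul1r.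
move/eqP; rewrite monomial // => /(simplest_cubic_conj _ _ _ _ fx fy).
by rewrite -monomial // => /eqP.
Qed.

(* The conjugate [- (x + 1)^-1] acts on the exponents by the order 3 matrix
   [(i, j) |-> (j, - i - j)], whose norm form [i ^ 2 + i j + j ^ 2] is
   anisotropic. *)
Lemma simplest_cubic_indep (a : int) (x : algC) (i j : int) :
  root (simplest_cubic algC a) x ->
  x ^ i * (x + 1) ^ j = 1 -> i = 0 /\ j = 0.
Proof.
move=> fx xij.
have x0 := simplest_cubic_neq0 _ _ fx.
have y0 := simplest_cubic_neq0_1 _ _ fx.
have fx' := simplest_cubic_conj_root _ _ fx.
have x'ij := simplest_cubic_conj_monomial _ _ _ _ _ fx fx' xij.
have x'1 : - (x + 1)^-1 + 1 = x / (x + 1) by field.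
pose A := `|x|; pose B := `|x + 1|.
have A0 : A != 0 by rewrite normr_eq0.
have B0 : B != 0 by rewrite normr_eq0.
have normz (z : algC) (k : int) : `|z ^ k| = `|z| ^ k.
  by case: k => n; rewrite ?NegzE -?invr_expz ?normfV -!exprnP normrX.
have e1 : A ^ i * B ^ j = 1 by rewrite -!normz -normrM xij normr1.
have e2 : A ^ j * B ^ (- (i + j)) = 1.
  have : `|(- (x + 1)^-1) ^ i * (x / (x + 1)) ^ j| = 1 by rewrite -x'1 x'ij normr1.
  rewrite normrM !normz normrN normrM normfV expfzMl -/A -/B !exprz_inv => <-.
  by rewrite opprD expfzDr // mulrCA.
have [N0 | N0] := eqVneq (i * (i + j) + j * j) 0; first by nia.
(* Cramer's rule on exponents: [e1] and [e2] form a linear system in log A and log B with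
   determinant minus the norm form. This combination eliminates B, the next one A. *)
have AN : A ^ (i * (i + j) + j * j) = 1.
  transitivity ((A ^ i * B ^ j) ^ (i + j) * (A ^ j * B ^ (- (i + j))) ^ j).
    rewrite !expfzMl !exprz_exp mulrACA -!expfzDr //.
    by rewrite [X in B ^ X](_ : _ = 0) ?expr0z ?mulr1 //; ring.
  by rewrite e1 e2 !exp1rz mulr1.
have BN : B ^ (i * (i + j) + j * j) = 1.
  transitivity ((A ^ i * B ^ j) ^ j * (A ^ j * B ^ (- (i + j))) ^ (- i)).
    rewrite !expfzMl !exprz_exp mulrACA -!expfzDr //.
    rewrite [X in A ^ X](_ : _ = 0) ?expr0z ?mul1r; last by ring.
    by congr (_ ^ _); ring.
  by rewrite e1 e2 !exp1rz mulr1.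
move/eqP: AN; rewrite pexprz_eq1 ?normr_ge0 // (negPf N0) /= => /eqP A1.
move/eqP: BN; rewrite pexprz_eq1 ?normr_ge0 // (negPf N0) /= => /eqP B1.
have xx : x * x^* = 1 by rewrite -normCK -/A A1 expr1n.
have yy : (x + 1) * (x^* + 1) = 1.
  by rewrite -[1 in X in _ * X]conjC1 -rmorphD -normCK -/B B1 expr1n.
(* Subtracting the two norm equations gives the trace x + x^* = -1. *)
have xE : x ^+ 2 = - x - 1.
  have x'E : x^* = - x - 1.
    transitivity ((x + 1) * (x^* + 1) - x * x^* - x - 1); first by ring.
    by rewrite yy xx; ring.
  by move: xx; rewrite x'E => xx; rewrite -[in RHS]xx; ring.
have := fx; rewrite root_simplest_cubic => /eqP f0.
(* Modulo X^2 + X + 1 the cubic reduces to a - 1 - 3 X. *)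
have x3 : x = ratr ((a - 1)%:~R / 3).
  rewrite fmorph_div rmorph_int rmorph_nat; apply: (mulIf (_ : 3 != 0)).
    by rewrite pnatr_eq0.
  rewrite divfK ?pnatr_eq0 // -[RHS]subr0 -f0.
  by rewrite exprS xE mulrBr mulrN -expr2 xE; ring.
have : root (simplest_cubic algC a) (ratr ((a - 1)%:~R / 3)) by rewrite -x3.
rewrite -(map_simplest_cubic _ _ (@ratr algC)) fmorph_root.
by rewrite (negPf (simplest_cubic_norootQ _ _)).
Qed.

(** * Elements and units of Z[x] *)

Lemma in_ZadjX (x : algC) : in_Zadj x x.
Proof. by exists 'X; rewrite map_polyX hornerX. Qed.

Lemma in_Zadj_int (x : algC) (z : int) : in_Zadj x z%:~R.
Proof. by exists z%:P; rewrite map_polyC hornerC. Qed.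

Lemma in_ZadjD (x u v : algC) : in_Zadj x u -> in_Zadj x v -> in_Zadj x (u + v).
Proof. by move=> [p ->] [q ->]; exists (p + q); rewrite rmorphD hornerD. Qed.

Lemma in_ZadjB (x u v : algC) : in_Zadj x u -> in_Zadj x v -> in_Zadj x (u - v).
Proof. by move=> [p ->] [q ->]; exists (p - q); rewrite rmorphB hornerD hornerN. Qed.

Lemma in_ZadjM (x u v : algC) : in_Zadj x u -> in_Zadj x v -> in_Zadj x (u * v).
Proof. by move=> [p ->] [q ->]; exists (p * q); rewrite rmorphM hornerM. Qed.

Lemma is_unit_of_ZadjM (x u v : algC) :
  is_unit_of (in_Zadj x) u -> is_unit_of (in_Zadj x) v ->
  is_unit_of (in_Zadj x) (u * v).
Proof.
move=> [Ru [u' [Ru' uu']]] [Rv [v' [Rv' vv']]]; split; first exact: in_ZadjM.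
by exists (u' * v'); split; [exact: in_ZadjM | rewrite mulrACA uu' vv' mulr1].
Qed.

Lemma is_unit_of_Zadj_sign (x : algC) (n : nat) : is_unit_of (in_Zadj x) ((-1) ^+ n).
Proof.
have := in_Zadj_int x ((-1) ^+ n); rewrite rmorphXn rmorphN1 => RN.
by split=> //; exists ((-1) ^+ n); rewrite -expr2 sqrr_sign.
Qed.

Lemma is_unit_of_ZadjXz (x u : algC) (k : int) :
  is_unit_of (in_Zadj x) u -> is_unit_of (in_Zadj x) (u ^ k).
Proof.
move=> Uu.
have UX (v : algC) n : is_unit_of (in_Zadj x) v -> is_unit_of (in_Zadj x) (v ^+ n).
  move=> Uv; elim: n => [|n IHn]; first exact: (is_unit_of_Zadj_sign x 0).
  by rewrite exprS; exact: is_unit_of_ZadjM.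
case: k => n; first exact: UX.
rewrite NegzE -invr_expz -exprVn; apply: UX.
case: Uu => Ru [u' [Ru' uu']].
have u0 : u != 0 by apply: contra_eqN uu' => /eqP->; rewrite mul0r eq_sym oner_eq0.
have -> : u^-1 = u' by apply: (mulfI u0); rewrite uu' divff.
by split=> //; exists u; rewrite mulrC.
Qed.

(** * Chips as units, and the resulting representations *)

Definition chip : eqType := (bool * int * int)%type.

Definition chip_val (x : algC) (t : chip) : algC :=
  (-1) ^+ t.1.1 * (x ^ t.1.2 * (x + 1) ^ t.2).

Lemma chip_val_inj (a : int) (x : algC) :
  root (simplest_cubic algC a) x -> injective (chip_val x).
Proof.
move=> fx [[b i] j] [[c k] l]; rewrite /chip_val /= => bc.
have x0 := simplest_cubic_neq0 _ _ fx.
have y0 := simplest_cubic_neq0_1 _ _ fx.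
have sgn : x ^ (i - k) * (x + 1) ^ (j - l) = (-1) ^+ (b (+) c).
  rewrite !expfzDr // -!invr_expz mulf_div signr_addb.
  apply: (canLR (mulfK _)); first by rewrite mulf_neq0 ?expfz_neq0.
  by rewrite -mulrA -bc mulrA -expr2 sqrr_sign mul1r.
(* Exponents are doubled because squaring removes the sign, leaving a relation to which independence
   applies. *)
have [] := simplest_cubic_indep a x ((i - k) * 2) ((j - l) * 2) fx.
  by rewrite -!exprz_exp -expfzMl sgn -exprnP sqrr_sign.
move=> ik jl; have {ik}ik: i = k by lia. have {jl}jl: j = l by lia.
move: sgn; rewrite ik jl !subrr !expr0z mulr1.
have n11 : (1 : algC) == -1 = false by rewrite -subr_eq0 opprK (pnatr_eq0 _ 2).
by case: b c {bc} => [] [] //= /eqP; rewrite expr1 n11.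
Qed.

(* Since [1], [x], [- (x + 1)] add up to [0], the sum of their cubes is three
   times their product; divide by [- x (x + 1)]. *)
Lemma chip_val_fire (x : algC) (b : bool) (i j : int) :
  x != 0 -> x + 1 != 0 ->
  chip_val x (b, i, j) *+ 3 =
    chip_val x (~~ b, i - 1, j - 1) + chip_val x (~~ b, i + 2, j - 1)
    + chip_val x (b, i - 1, j + 2).
Proof.
move=> x0 y0; rewrite /chip_val /=.
rewrite !expfzDr // -!invr_expz !expr1z signrN.
by field; apply/andP.
Qed.

(** Horner's scheme: multiplication by x shifts the first exponent, and a constant c is [|c|] chips
    on the unit 1 or -1. *)
Lemma chips_of_Zadj (x u : algC) :
  x != 0 -> in_Zadj x u -> exists s : seq chip, u = \sum_(t <- s) chip_val x t.
Proof.
move=> x0 [p ->]; elim/poly_ind: p => [|p c [s IHs]].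
  by exists [::]; rewrite rmorph0 horner0 big_nil.
exists ([seq (t.1.1, t.1.2 + 1, t.2) | t <- s] ++ nseq `|c| (c < 0, 0, 0)).
rewrite rmorphD rmorphM /= map_polyX map_polyC hornerMXaddC IHs big_cat big_map /=.
congr (_ + _).
  rewrite mulr_suml; apply: eq_bigr => t _.
  by rewrite /chip_val /= expfzDr // expr1z -mulrA; congr (_ * _); rewrite mulrAC.
rewrite big_nseq -Monoid.iteropE /chip_val /= !expr0z !mulr1.
by rewrite {1}(intEsign c) rmorphM rmorphXn rmorphN1 mulr_natr.
Qed.

(** Multiplicities become coefficients, sorted in decreasing order. *)
Lemma unit_rep_of_seq (R : algC -> Prop) (k : nat) (s : seq algC) :
  (forall nu, nu \in s -> is_unit_of R nu) ->
  (forall nu, count_mem nu s <= k)%N -> omega_le R (\sum_(nu <- s) nu) k.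
Proof.
move=> sU sk; right.
pose r := sort (fun u v : nat * algC => v.1 <= u.1)%N
               [seq (count_mem nu s, nu) | nu <- undup s].
have rE : perm_eq r [seq (count_mem nu s, nu) | nu <- undup s] by rewrite perm_sort.
have rP v : v \in r -> exists2 nu, nu \in s & v = (count_mem nu s, nu).
  by rewrite (perm_mem rE) => /mapP[nu]; rewrite mem_undup; exists nu.
exists r; split; first split.
- by rewrite sorted_map; apply: sort_sorted => u v; exact: leq_total.
- by apply/allP => v /rP[nu nus ->]; rewrite /= -has_count has_pred1.
- by rewrite (perm_uniq (perm_map _ rE)) -map_comp map_id undup_uniq.
- by move=> v /rP[nu nus ->]; exact: sU.
- rewrite (perm_big _ rE) big_map /= -[LHS]big_undup_iterop_count.
  by apply: eq_bigr => nu _; rewrite mulr_natl.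
(* An empty list has head 0 by default, so only a nonempty one needs the multiplicity bound. *)
- case: r rP {rE} => // v r rP.
  by have [nu _ ->] := rP v (mem_head _ _); exact: sk.
Qed.

Theorem theorem2 (a : int) (alpha : algC)
  (halpha : alpha ^+ 3 - (a - 1)%:~R * alpha ^+ 2 - (a + 2)%:~R * alpha - 1 = 0) :
  omega_ring_le (in_Zadj alpha) 2.
Proof.
have fx : root (simplest_cubic algC a) alpha by rewrite root_simplest_cubic halpha.
have x0 := simplest_cubic_neq0 _ _ fx.
have y0 := simplest_cubic_neq0_1 _ _ fx.
move=> beta /(chips_of_Zadj _ _ x0)[s0 ->].
have [] := @chip_firing chip _ (chip_val alpha)
  (fun t => (~~ t.1.1, t.1.2 - 1, t.2 - 1)) (fun t => (~~ t.1.1, t.1.2 + 2, t.2 - 1))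
  (fun t => (t.1.1, t.1.2 - 1, t.2 + 2)) (fun t => t.1.2 - t.2) 3 _ _ _ _ _ s0 => //=.
1-3: by move=> t; ring.
- by move=> [[b i] j]; exact: chip_val_fire.
move=> s [-> s2]; rewrite -(big_map (chip_val alpha) xpredT id).
apply: unit_rep_of_seq => nu.
  case/mapP=> t _ ->; apply: is_unit_of_ZadjM; first exact: is_unit_of_Zadj_sign.
  have R1 z := in_Zadj_int alpha z; have RX := in_ZadjX alpha.
  apply: is_unit_of_ZadjM; apply: is_unit_of_ZadjXz.
    split=> //; exists (alpha ^+ 2 - (a - 1)%:~R * alpha - (a + 2)%:~R).
    split; last exact: simplest_cubic_inv.
    by rewrite expr2; do 2!apply: in_ZadjB => //; exact: in_ZadjM.
  split; first exact: (in_ZadjD _ _ _ RX (R1 1)).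
  exists (a%:~R * alpha + 2 - alpha ^+ 2).
  split; last exact: simplest_cubic_inv1.
  rewrite expr2; apply: in_ZadjB; last exact: in_ZadjM.
  by apply: in_ZadjD (R1 2); exact: in_ZadjM.
(* By injectivity of [chip_val], the multiplicity of a unit is that of its unique chip. *)
have [/mapP[t _ ->]|nus] := boolP (nu \in map (chip_val alpha) s); last first.
  by rewrite (count_memPn nus).
rewrite count_map (@eq_count _ _ (pred1 t)); first exact: s2.
by move=> t' /=; rewrite (inj_eq (chip_val_inj _ _ fx)).
Qed.
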